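(* Let $\Gamma=(V;E,\varepsilon)$ be a simple connected graph with $|V|=n\ge2$ and $|E|=m$, and let the odd prime $p$ satisfy $p>n+2m$. Let $a_m=\oplus_{e\in E}e\in\mathbb{E}$. Then: (i) for $a\in\mathbb{E}$: $s_\rho(a)=-2|\sigma(a)| \bmod p$ if and only if $\Gamma(a)$ is a matching; (ii) $\chi_\rho(a_m)=n \bmod p$ if and only if $\Gamma$ is Eulerian; (iii) for $a\in\mathbb{E}$: $\chi_\rho(a)=s_\rho(a)$ if and only if $\Gamma(a)$ is a cover of $\Gamma$, that is, every vertex of $\Gamma$ is incident to some edge in $\sigma(a)$.
   Context: Graphs are finite. A graph is a triple $\Gamma=(V;E,\varepsilon)$ with vertex set $V$, edge set $E$ and a map $\varepsilon$ from $E$ to the set of subsets of $V$ with one or two elements; it is simple if every $\varepsilon(e)$ has exactly two elements and $\varepsilon$ is injective. A graph is Eulerian if it has a closed chain (closed walk with pairwise distinct edges) passing through every edge exactly once. Fix an odd prime $p$ and an algebraic closure $\overline{\mathbb{F}}_p$ of $\mathbb{F}_p$. Let $\mathbb{E}=\mathbb{F}_2[E]$ be the $\mathbb{F}_2$-vector space with basis $E$, viewed as an abelian group (law written $\oplus$). For $a=\oplus_{e\in E}a_e e\in\mathbb{E}$ with $a_e\in\{0,1\}$, the support of $a$ is $\sigma(a)=\{e\in E: a_e\ne0\}$, and $\chi_a:\mathbb{E}\to\{\pm1\}\subset\mathbb{F}_p^\times$ is the homomorphism with $\chi_a(e)=(-1)^{a_e}$ for $e\in E$. $\Gamma(a)$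 is the subgraph of $\Gamma$ induced by the edges in $\sigma(a)$: its edge set is $\sigma(a)$ and its vertex set $V(\Gamma(a))$ is the set of vertices incident to some edge of $\sigma(a)$. $\Gamma(a)$ is a matching if the edges in $\sigma(a)$ pairwise have no common vertex. Define $\gamma:V\to\mathbb{E}$ by $\gamma(x)=\oplus_{e:\,x\in\varepsilon(e)}e$, let $\mathbb{V}=\overline{\mathbb{F}}_p[V]$ be the $\overline{\mathbb{F}}_p$-vector space with basis $V$, and let $\rho=\rho_\Gamma:\mathbb{E}\to GL(\mathbb{V})$ be the representation with $\rho(a)(x)=\chi_{\gamma(x)}(a)\,x$ for $a\in\mathbb{E}$, $x\in V$. Its character is $\chi_\rho(a)=\mathrm{Tr}(\rho(a))$, which lies in $\mathbb{F}_p$. The signature of the character is $$s_\rho(a)=\sum_{x\in V(\Gamma(a))}(-1)^{\deg_{\Gamma(a)}(x)}\in\mathbb{F}_p .$$ *)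

(* Defs.v *)
From HB Require Import structures.
From mathcomp Require Import all_boot all_order all_algebra all_fingroup.
From mathcomp Require Import all_solvable all_field all_character.

Set Implicit Arguments.
Unset Strict Implicit.
Unset Printing Implicit Defensive.

Import GRing.Theory.
Local Open Scope ring_scope.

(* Loops are the edges e with #|ends e| = 1; parallel edges are allowed. *)
Record graph := Graph {
  vert : finType;
  edge : finType;
  ends : edge -> {set vert};
  ends_card : forall e : edge, (0 < #|ends e| <= 2)%N
}.

Arguments ends {g}.

Section Graphs.
Variable Gm : graph.

Definition simple_graph : Prop :=
  (forall e : edge Gm, #|ends e| = 2%N) /\ injective (@ends Gm).

Definition adjacent : rel (vert Gm) :=
  fun x y => [exists e : edge Gm, ends e == [set x; y]].

Definition connected_graph : Prop :=
  forall x y : vert Gm, connect adjacent x y.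

(* A walk from x is recorded as its successive steps (edge, next vertex).
   A loop at x satisfies ends e = [set x; x] = [set x]. *)
Fixpoint is_walk (x : vert Gm) (w : seq (edge Gm * vert Gm)) : bool :=
  if w is (e, y) :: w' then (ends e == [set x; y]) && is_walk y w' else true.

Definition walk_edges (w : seq (edge Gm * vert Gm)) : seq (edge Gm) :=
  [seq s.1 | s <- w].

Definition walk_end (x : vert Gm) (w : seq (edge Gm * vert Gm)) : vert Gm :=
  last x [seq s.2 | s <- w].

Definition closed_chain (x : vert Gm) (w : seq (edge Gm * vert Gm)) : Prop :=
  [/\ is_walk x w, walk_end x w = x & uniq (walk_edges w)].

Definition eulerian : Prop :=
  exists x : vert Gm, exists w : seq (edge Gm * vert Gm),
    closed_chain x w /\ (forall e : edge Gm, e \in walk_edges w).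

Definition edge_space : Type := {ffun edge Gm -> 'F_2}.
HB.instance Definition _ := GRing.Zmodule.on edge_space.
HB.instance Definition _ := Finite.on edge_space.
HB.instance Definition _ := [finGroupMixin of edge_space for +%R].

Definition ecoef (a : edge_space) (e : edge Gm) : 'F_2 :=
  (a : {ffun edge Gm -> 'F_2}) e.

Definition ebasis (e : edge Gm) : edge_space :=
  [ffun f : edge Gm => ((f == e)%:R : 'F_2)].

Definition esupp (a : edge_space) : {set edge Gm} :=
  [set e | ecoef a e != 0].

Definition all_edges : edge_space := \sum_(e : edge Gm) ebasis e.

(* The vertex set of the subgraph Gamma(a), whose edge set is [esupp a]. *)
Definition sub_vert (a : edge_space) : {set vert Gm} :=
  [set x | [exists e in esupp a, x \in ends e]].

(* The degree of x in Gamma(a); a loop counts twice. *)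
Definition sub_deg (a : edge_space) (x : vert Gm) : nat :=
  (#|[set e in esupp a | x \in ends e]| +
   #|[set e in esupp a | ends e == [set x]]|)%N.

Definition sub_matching (a : edge_space) : Prop :=
  {in esupp a &, forall e f, e != f -> [disjoint ends e & ends f]}.

Definition sub_cover (a : edge_space) : Prop :=
  forall x : vert Gm, exists2 e, e \in esupp a & x \in ends e.

Definition gam (x : vert Gm) : edge_space :=
  \sum_(e : edge Gm | x \in ends e) ebasis e.

Section Characters.
Variable p : nat.

(* The multiplicative extension of e |-> (-1)^(a_e): by definition b is the
   sum of the basis vectors in its support; see [chi_ebasis] and [chiD]. *)
Definition chi (a b : edge_space) : 'F_p :=
  \prod_(e in esupp b) (-1) ^+ (ecoef a e : nat).

Lemma esupp_ebasis e : esupp (ebasis e) = [set e].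
Proof. by apply/setP=> f; rewrite !inE /ecoef ffunE; case: (f == e). Qed.

Lemma chi_ebasis a e : chi a (ebasis e) = (-1) ^+ (ecoef a e : nat).
Proof. by rewrite /chi esupp_ebasis big_set1. Qed.

Lemma chi0 a : chi a 0 = 1.
Proof. by rewrite /chi big1 // => e; rewrite inE /ecoef ffunE eqxx. Qed.

Lemma chiD a b c : chi a (b + c) = chi a b * chi a c.
Proof.
rewrite /chi big_mkcond [in RHS]big_mkcond [X in _ * X]big_mkcond /=.
rewrite -big_split /=; apply: eq_bigr => e _.
rewrite !inE /ecoef ffunE.
set s := (-1) ^+ _; have ss : s * s = 1 by rewrite -expr2 exprAC sqrrN !expr1n.
by case: (b e) => [[|[|?]]] // ?; case: (c e) => [[|[|?]]] // ?;
  rewrite -!val_eqE /= ?mulr1 ?mul1r ?ss.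
Qed.

Definition signature (a : edge_space) : 'F_p :=
  \sum_(x in sub_vert a) (-1) ^+ sub_deg a x.

Variables (K : fieldType) (iota : {rmorphism 'F_p -> K}).

(* The matrix of rho(a) in the basis of vertices, enumerated by [enum_val]. *)
Definition rho_mx (a : edge_space) : 'M[K]_#|vert Gm| :=
  diag_mx (\row_i iota (chi (gam (enum_val i)) a)).

Lemma rho_mx_repr : mx_repr [set: edge_space] rho_mx.
Proof.
split=> [|a b _ _]; rewrite /rho_mx.
  rewrite -diag_const_mx; congr diag_mx; apply/rowP=> i.
  by rewrite !mxE -[1%g]/(0 : edge_space) chi0 rmorph1.
rewrite mulmx_diag; congr diag_mx; apply/rowP=> i.
by rewrite !mxE -[(a * b)%g]/(a + b) chiD rmorphM.
Qed.

Definition rho : mx_representation K [set: edge_space] #|vert Gm| :=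
  MxRepresentation rho_mx_repr.

Lemma rho_vertex (a : edge_space) (x : vert Gm) :
  delta_mx 0 (enum_rank x) *m rho a
    = iota (chi (gam x) a) *: delta_mx (0 : 'I_1) (enum_rank x).
Proof.
rewrite -rowE; apply/rowP=> j; rewrite !mxE /= eq_sym.
by rewrite enum_rankK mulr_natr.
Qed.

Definition char_rho (a : edge_space) : K := \tr (rho a).

End Characters.
End Graphs.

(* Main.v *)
Require Import Defs.
From Stdlib Require Import Setoid.
From mathcomp Require Import all_boot all_order all_algebra all_fingroup.
From mathcomp Require Import all_solvable all_field all_character.

Import GRing.Theory.
Local Open Scope ring_scope.

(* Let d(x) be the degree of x in Gamma(a). Since chi_{gamma(x)}(a) = (-1)^d(x),
   both the character and the signature are sums of signs (-1)^d(x).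
   The equalities modulo p become equalities of natural numbers because each one
   says that p divides a certain natural number which cannot be a nonzero multiple of p:
   (i) sum_x ((-1)^d(x) + d(x)) over the vertices of Gamma(a), whose terms are
   nonnegative and vanish exactly when d(x) = 1;
   (ii) twice the number of vertices of odd degree, so that the claim is
   Euler's theorem, proved by extending a trail of maximal length;
   (iii) the number of vertices not covered by Gamma(a). *)

Section Trails.
Variable Gm : graph.
Implicit Types (x y v : vert Gm) (e : edge Gm).
Implicit Types (w : seq (edge Gm * vert Gm)) (a : edge_space Gm).

(** * Walks, trails and the rotation of closed trails *)

Definition trail x w : bool := is_walk x w && uniq (walk_edges w).

Lemma is_walk_cat x w1 w2 :
  is_walk x (w1 ++ w2) = is_walk x w1 && is_walk (walk_end x w1) w2.
Proof. by elim: w1 x => //= -[e y] w1 IH x /=; rewrite IH andbA. Qed.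

Lemma walk_end_cat x w1 w2 :
  walk_end x (w1 ++ w2) = walk_end (walk_end x w1) w2.
Proof. by rewrite /walk_end map_cat last_cat. Qed.

Lemma walk_edges_cat w1 w2 :
  walk_edges (w1 ++ w2) = walk_edges w1 ++ walk_edges w2.
Proof. exact: map_cat. Qed.

Lemma walk_split x w v :
  v \in x :: [seq s.2 | s <- w] ->
  exists w1 w2, w = w1 ++ w2 /\ walk_end x w1 = v.
Proof.
elim: w x => [|[e y] w IH] x; rewrite inE.
  by move=> /eqP->; exists [::], [::].
case/predU1P=> [->|/IH[w1 [w2 [-> <-]]]]; first by exists [::], ((e, y) :: w).
by exists ((e, y) :: w1), w2.
Qed.

(** Cut the closed trail at a visit to [v] and swap the two pieces. *)
Lemma closed_trail_rot x w v :
  trail x w -> walk_end x w = x -> v \in x :: [seq s.2 | s <- w] ->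
  exists w', [/\ trail v w', walk_end v w' = v & perm_eq w' w].
Proof.
move=> /andP[ww uw] wx /walk_split[w1 [w2 [dw v1]]].
move: ww uw wx; rewrite {}dw is_walk_cat walk_end_cat v1 => /andP[ww1 ww2] uw w2x.
have pw : perm_eq (w2 ++ w1) (w1 ++ w2) by rewrite perm_catC.
exists (w2 ++ w1); split=> //; last by rewrite walk_end_cat w2x.
rewrite /trail is_walk_cat ww2 w2x ww1 /=.
by rewrite (perm_uniq (perm_map _ pw)).
Qed.

Lemma walk_edge_vert x w e v :
  is_walk x w -> e \in walk_edges w -> v \in ends e ->
  v \in x :: [seq s.2 | s <- w].
Proof.
elim: w x => //= -[f y] w IH x /= /andP[/eqP ef wy].
rewrite inE => /predU1P[->|ew] ve.
  by move: ve; rewrite ef !inE orbA => ->.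
by rewrite inE (IH y) ?orbT.
Qed.

Section Loopless.
Hypothesis loopless : forall e, #|ends e| = 2%N.

Lemma ends_neq e x y : ends e = [set x; y] -> x != y.
Proof. by move=> exy; have := loopless e; rewrite exy cards2; case: eqP. Qed.

Lemma ends_other e x : x \in ends e -> exists y, ends e = [set x; y].
Proof.
have /eqP/cards2P[y [z [_ ->]]] := loopless e.
by rewrite !inE => /orP[]/eqP->; [exists z | exists y; rewrite setUC].
Qed.

(** A step along an edge with ends [x != y] changes the parity by [(v == x) (+) (v == y)]; these
    contributions telescope along the walk. *)
Lemma odd_count_walk x w v :
  is_walk x w ->
  odd (count (fun e => v \in ends e) (walk_edges w)) =
    (v == x) (+) (v == walk_end x w).
Proof.
elim: w x => [|[e y] w IH] x; first by move=> _; rewrite [RHS]addbb.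
case/andP=> /eqP exy /IH; rewrite [count _ _]/= oddD => ->.
have -> : walk_end x ((e, y) :: w) = walk_end y w by [].
have := ends_neq e x y exy; rewrite exy !inE.
have [->|vx] := eqVneq v x; last by case: (v == y); case: (v == _).
by move/negbTE->.
Qed.

Lemma count_uniq_edges (s : seq (edge Gm)) v :
  uniq s ->
  count (fun e => v \in ends e) s = #|[set e in s | v \in ends e]|.
Proof.
move=> us; rewrite -size_filter -(card_uniqP (filter_uniq _ us)).
by apply: eq_card => e; rewrite inE mem_filter andbC.
Qed.

(** * Euler's theorem *)

Lemma eulerian_even :
  eulerian Gm -> forall v, ~~ odd #|[set e | v \in ends e]|.
Proof.
case=> x [w [[ww wx uw] allw]] v.
have -> : [set e | v \in ends e] = [set e in walk_edges w | v \in ends e].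
  by apply/setP=> e; rewrite !inE allw.
by rewrite -count_uniq_edges // (odd_count_walk _ _ _ ww) wx addbb.
Qed.

Lemma longest_trail x0 :
  exists x w, trail x w /\
    forall x' w', trail x' w' -> (size w' <= size w)%N.
Proof.
(* Tuples of a fixed length form a finite type, so [P] is a boolean predicate. It is bounded because
   a trail repeats no edge. *)
pose P k := [exists x, exists w : k.-tuple (edge Gm * vert Gm), trail x w].
have P0 : exists k, P k.
  by exists 0; apply/existsP; exists x0; apply/existsP; exists [tuple].
have PI x w : trail x w -> P (size w).
  by move=> tw; apply/existsP; exists x; apply/existsP; exists (in_tuple w).
have Pb k : P k -> (k <= #|edge Gm|)%N.
  case/existsP=> x /existsP[w /andP[_ uw]].
  by rewrite -(size_tuple w) -(size_map fst) -(card_uniqP uw) max_card.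
case: (ex_maxnP P0 Pb) => k /existsP[x /existsP[w tw]] kmax.
by exists x, w; split=> // x' w' /PI/kmax; rewrite size_tuple.
Qed.

Lemma trail_extend x w e :
  trail x w -> walk_end x w \in ends e -> e \notin walk_edges w ->
  exists w', trail x w' /\ size w' = (size w).+1.
Proof.
move=> /andP[ww uw] /ends_other[y ey] ew; exists (w ++ [:: (e, y)]).
split; last by rewrite size_cat addn1.
rewrite /trail is_walk_cat ww /= ey eqxx /= walk_edges_cat cat_uniq uw /=.
by rewrite orbF ew.
Qed.

Lemma even_eulerian x0 :
  connected_graph Gm -> (forall v, ~~ odd #|[set e | v \in ends e]|) ->
  eulerian Gm.
Proof.
move=> conn even; have [x [w [tw wmax]]] := longest_trail x0.
have used y w' e : trail y w' -> size w' = size w ->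
    walk_end y w' \in ends e -> e \in walk_edges w'.
  move=> tw' sw' ye; apply/negPn/negP=> /(trail_extend _ _ _ tw' ye)[w2 [/wmax]].
  by rewrite sw' => + s2; rewrite s2 ltnn.
have /andP[ww uw] := tw.
(* By maximality all edges at the end are in the trail; there are evenly many of them, whereas the
   end of an open trail meets an odd number of its edges. *)
have wx : walk_end x w = x.
  apply/eqP; have := even (walk_end x w).
  have -> : [set e | walk_end x w \in ends e] =
            [set e in walk_edges w | walk_end x w \in ends e].
    apply/setP=> e; rewrite !inE andbC; case: (boolP (_ \in _)) => //= xe.
    by rewrite (used x).
  by rewrite -count_uniq_edges // (odd_count_walk _ _ _ ww) eqxx addbT negbK.
(* Rotation turns any visited vertex into the end of a trail that is still of maximal length. *)
have usedW v e : v \in x :: [seq s.2 | s <- w] -> v \in ends e ->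
    e \in walk_edges w.
  case/(closed_trail_rot _ _ _ tw wx)=> w' [tw' w'v pw] ve.
  rewrite -(perm_mem (perm_map _ pw)).
  by apply: (used v); rewrite ?w'v ?(perm_size pw).
have allW v : v \in x :: [seq s.2 | s <- w].
  have /connectP[q] := conn x v; have: x \in x :: [seq s.2 | s <- w].
    exact: mem_head.
  (* Only the start of the path is generalized; the start of the trail stays [x]. *)
  elim: q {1 3 4}x => [|u q IH] y yW /=; first by move=> _ ->.
  case/andP=> /existsP[e /eqP eyu] qu lq; apply: (IH u) => //.
  apply: (walk_edge_vert _ _ e _ ww); last by rewrite eyu !inE eqxx orbT.
  by apply: (usedW y); rewrite // eyu !inE eqxx.
exists x, w; split=> // e.
have /card_gt0P[v ve] : (0 < #|ends e|)%N by rewrite loopless.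
exact: (usedW v).
Qed.

(** * Degrees in the subgraph of [a] *)

Lemma sub_degE a x : sub_deg a x = #|[set e in esupp a | x \in ends e]|.
Proof.
rewrite /sub_deg [X in (_ + X)%N](_ : _ = 0%N) ?addn0 //.
apply: eq_card0 => e; rewrite !inE; apply/negP=> /andP[_ /eqP ex].
by have := loopless e; rewrite ex cards1.
Qed.

Lemma sub_vertE a x : (x \in sub_vert a) = (0 < sub_deg a x)%N.
Proof.
rewrite sub_degE inE; apply/existsP/card_gt0P=> -[e ex];
  by exists e; move: ex; rewrite inE.
Qed.

(** Double counting of incident pairs: each edge of the support has two ends. *)
Lemma handshake a :
  (\sum_(x in sub_vert a) sub_deg a x = 2 * #|esupp a|)%N.
Proof.
rewrite big_mkcond /= (eq_bigr (sub_deg a)) => [|x _]; last first.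
  by rewrite sub_vertE; case: posnP.
under eq_bigr do rewrite sub_degE -sum1dep_card.
rewrite (exchange_big_dep (mem (esupp a))) /=; last by move=> x e _ /andP[].
rewrite mulnC -sum_nat_const; apply: eq_bigr => e ea.
by rewrite sum1dep_card -[RHS](loopless e); apply: eq_card => x; rewrite inE ea.
Qed.

(** A vertex of the subgraph has degree at least 1, and degree at least 2 means that two distinct
    edges of the support meet there. *)
Lemma matchingP a :
  sub_matching a <-> {in sub_vert a, forall x, sub_deg a x = 1%N}.
Proof.
split=> [mat x | deg1 e f ea fa ef].
  rewrite sub_vertE => dx; apply/eqP; rewrite eqn_leq dx andbT.
  rewrite sub_degE; apply/card_le1_eqP => e f; rewrite !inE.
  move=> /andP[ea xe] /andP[fa xf]; apply/eqP/negPn/negP; rewrite eq_sym => ef.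
  have := mat e f; rewrite !inE => /(_ ea fa ef)/disjointFr/(_ xe).
  by rewrite xf.
rewrite disjoint_subset; apply/subsetP=> x xe; apply/negP=> /= xf.
have /deg1/eqP : x \in sub_vert a by rewrite inE; apply/exists_inP; exists e.
rewrite sub_degE => /eqP d1.
have /card_le1_eqP d2 : (#|[set e in esupp a | x \in ends e]| <= 1)%N by rewrite d1.
have [xe' xf'] : e \in [set e in esupp a | x \in ends e] /\
   f \in [set e in esupp a | x \in ends e].
  by split; rewrite inE ?ea ?fa ?xe ?xf.
by move: ef; rewrite (d2 e f) ?eqxx.
Qed.

Lemma coverP a : sub_cover a <-> #|~: sub_vert a| = 0%N.
Proof.
split=> [cov | /eqP c0 x].
  apply: eq_card0 => x; rewrite in_setC; apply/negbF; rewrite inE.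
  by apply/exists_inP; exact: cov.
move: c0; rewrite cards_eq0 => /eqP/setP/(_ x).
by rewrite in_setC in_set0 => /negbFE; rewrite inE => /exists_inP.
Qed.

(** * Characters in terms of degrees *)

Lemma ecoef_sum (P : pred (edge Gm)) e :
  ecoef (\sum_(f | P f) ebasis f) e = (P e)%:R.
Proof.
have /= -> := big_morph (@ecoef Gm ^~ e) (id1 := 0) (op1 := +%R);
  [| by move=> a b; rewrite /ecoef ffunE | by rewrite /ecoef ffunE].
under eq_bigr do rewrite /ecoef /ebasis ffunE.
rewrite big_mkcond (bigD1 e) //= eqxx big1 ?addr0; first by case: (P e).
by move=> f fe; rewrite eq_sym (negbTE fe); case: (P f).
Qed.

Lemma esupp_all : esupp (all_edges Gm) = setT.
Proof. by apply/setP=> e; rewrite !inE ecoef_sum. Qed.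

(** The coefficient of [gam x] is 1 exactly at the edges through [x], so each such edge in the
    support of [a] contributes a factor -1. *)
Lemma chi_gam p a x : chi p (gam x) a = (-1) ^+ sub_deg a x.
Proof.
rewrite /chi sub_degE -prodr_const.
under eq_bigr do rewrite ecoef_sum.
rewrite [RHS]big_mkcond [LHS]big_mkcond; apply: eq_bigr => e _ /=.
by rewrite [in RHS]inE; case: (e \in _) => //=; case: (x \in _).
Qed.

Lemma char_rhoE p (K : fieldType) (iota : {rmorphism 'F_p -> K}) a :
  char_rho iota a = iota (\sum_x (-1) ^+ sub_deg a x).
Proof.
rewrite /char_rho /= /rho_mx mxtrace_diag rmorph_sum.
rewrite (reindex (@enum_rank _)) /=; last exact/onW_bij/enum_rank_bij.
by apply: eq_bigr => x _; rewrite mxE enum_rankK chi_gam.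
Qed.

End Loopless.
End Trails.

(** * From congruences modulo [p] to natural numbers *)

Lemma natrFp_eq0 p k :
  prime p -> (k < p)%N -> (k%:R = 0 :> 'F_p) <-> k = 0%N.
Proof.
move=> p_pr kp; split=> [/eqP|-> //].
rewrite -(dvdn_pcharf (pchar_Fp p_pr)); case: k kp => // k kp.
by move/dvdn_leq=> /(_ isT); rewrite leqNgt kp.
Qed.

(** Exhibits each term of the sum in (i) as the image of a natural number; [d.-1] is not truncated,
    since an odd [d] is positive. *)
Lemma sign_add_natr (R : pzRingType) (d : nat) :
  (-1) ^+ d + d%:R = (if odd d then d.-1 else d.+1)%:R :> R.
Proof.
rewrite -signr_odd; case: d => [|d]; first by rewrite expr0 addr0.
case: (odd _); last by rewrite expr0 nat1r.
by rewrite expr1 -[d.+1%:R]nat1r addKr.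
Qed.

Theorem proposition7p4 (p : nat) (p_prime : prime p) (p_odd : odd p)
    (K : closedFieldType) (iota : {rmorphism 'F_p -> K})
    (iota_algebraic : integralRange iota)
    (Gm : graph) (n m : nat)
    (Gm_simple : simple_graph Gm) (Gm_connected : connected_graph Gm)
    (card_vert : #|vert Gm| = n) (card_edge : #|edge Gm| = m)
    (n_ge2 : (2 <= n)%N) (p_large : (n + 2 * m < p)%N) :
  [/\ forall a : edge_space Gm,
        signature p a = - (2 * #|esupp a|)%:R <-> sub_matching a,
      char_rho iota (all_edges Gm) = n%:R <-> eulerian Gm
    & forall a : edge_space Gm,
        char_rho iota a = iota (signature p a) <-> sub_cover a].
Proof.
have [loopless _] := Gm_simple.
have n_lt_p : (n < p)%N by apply: leq_ltn_trans p_large; rewrite leq_addr.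
split=> [a||a].
- pose t d := if odd d then d.-1 else d.+1.
  pose N := (\sum_(x in sub_vert a) t (sub_deg a x))%N.
  have sN : signature p a + (2 * #|esupp a|)%:R = N%:R.
    rewrite -handshake // !natr_sum -big_split /=.
    by apply: eq_bigr => x _; rewrite sign_add_natr.
  (* Since [t d <= d + 1], the handshake lemma bounds [N] by [n + 2 * m]. *)
  have Np : (N < p)%N.
    apply: leq_ltn_trans p_large; rewrite -card_vert -card_edge.
    apply: (@leq_trans (#|sub_vert a| + 2 * #|esupp a|)).
      rewrite -handshake // -sum1_card -big_split /=.
      by apply: leq_sum => x _; rewrite /t; case: odd => //;
        apply: leq_trans (leq_pred _) _; rewrite leq_addl.
    by apply: leq_add; rewrite ?leq_mul2l /= max_card.
  have -> : signature p a = - (2 * #|esupp a|)%:R <-> N%:R = 0 :> 'F_p.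
    by rewrite -sN; split=> [->|/eqP]; rewrite ?addNr // addr_eq0 => /eqP.
  rewrite natrFp_eq0 // matchingP //.
  have tdeg d : (0 < d)%N -> t d = 0%N <-> d = 1%N.
    by rewrite /t; case: d => [|[|d]] // _; split=> //; case: ifP.
  split=> [/eqP|deg1].
    rewrite sum_nat_eq0 => /forall_inP t0 x xa.
    by apply/tdeg; [rewrite -sub_vertE | apply/eqP/t0].
  by apply: big1 => x xa; apply/tdeg; [rewrite -sub_vertE | apply: deg1].
- pose O := [set x | odd (sub_deg (all_edges Gm) x)].
  (* A vertex of odd degree contributes -1 = 1 - 2. *)
  have charO : \sum_x (-1) ^+ sub_deg (all_edges Gm) x = n%:R - (2 * #|O|)%:R :> 'F_p.
    rewrite -card_vert -sum1_card -sum1_card big_distrr /= [in X in _ - X]big_mkcond.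
    rewrite !natr_sum -sumrB; apply: eq_bigr => x _.
    by rewrite inE -signr_odd; case: odd; rewrite ?subr0 // opprD addNKr.
  have evenP : #|O| = 0%N <-> forall x, ~~ odd #|[set e : edge Gm | x \in ends e]|.
    have degE (x : vert Gm) : sub_deg (all_edges Gm) x = #|[set e : edge Gm | x \in ends e]|.
      by rewrite sub_degE // esupp_all; apply: eq_card => e; rewrite !inE.
    split=> [/eqP|ev].
      rewrite cards_eq0 => /eqP/setP O0 x; have := O0 x.
      by rewrite inE degE inE => ->.
    by apply: eq_card0 => x; rewrite !inE degE; apply/negbTE.
  have [x0 _] : exists x0 : vert Gm, x0 \in vert Gm.
    by apply/card_gt0P; rewrite card_vert; apply: leq_trans n_ge2.
  rewrite char_rhoE // charO -(rmorph_nat iota).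
  have -> : iota (n%:R - (2 * #|O|)%:R) = iota n%:R <-> (2 * #|O|)%:R = 0 :> 'F_p.
    by split=> [/fmorph_inj/esym/eqP|->];
      rewrite ?subr0 // -subr_eq0 opprB addrC subrK => /eqP.
  (* Neither factor can be a nonzero multiple of [p]: [2 <= n < p] and [#|O| <= n < p]. *)
  have -> : (2 * #|O|)%:R = 0 :> 'F_p <-> #|O| = 0%N.
    split=> [|-> //]; rewrite natrM => /eqP; rewrite mulf_eq0 => /orP[]/eqP.
      have p2 : (2 < p)%N by apply: leq_ltn_trans n_lt_p.
      by move/(natrFp_eq0 _ _ p_prime p2).
    apply: (natrFp_eq0 _ _ p_prime _).1; apply: leq_ltn_trans n_lt_p.
    by rewrite -card_vert max_card.
  rewrite evenP; split; first exact: even_eulerian.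
  exact: eulerian_even.
- rewrite char_rhoE // coverP.
  (* An uncovered vertex has degree 0 and contributes 1. *)
  have -> : \sum_x (-1) ^+ sub_deg a x = signature p a + #|~: sub_vert a|%:R :> 'F_p.
    rewrite (bigID (mem (sub_vert a))) /=; congr (_ + _).
    rewrite -sum1_card natr_sum; apply: eq_big => [x|x]; first by rewrite in_setC.
    by rewrite sub_vertE // -eqn0Ngt => /eqP->.
  rewrite -(natrFp_eq0 p) //; last first.
    by apply: leq_ltn_trans n_lt_p; rewrite -card_vert max_card.
  by split=> [/fmorph_inj/eqP|->]; rewrite ?addr0 // -subr_eq0 addrAC subrr add0r => /eqP.
Qed.
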